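(* Let $\mathcal S$ be a complete separable metric space, $\mu$ a boundedly finite Borel measure on $\mathcal S$, $m\ge2$ an integer and $a,\rho,k>0$. Let $N$ be a multivariate generalized Waring process with parameters $a,k,\rho$ and parameter measure $\mu$, and for $i\in\{1,\dots,m\}$ let $N_i(\cdot)=N(\cdot\times\{i\})$. Then: (1) for every $i$, $N_i$ is a generalized Waring process on $\mathcal S$ with parameters $a,k,\rho$ and parameter measure $\mu$; (2) for distinct indices $i_1,\dots,i_l\in\{1,\dots,m\}$, $\sum_{j=1}^lN_{i_j}$ is a generalized Waring process on $\mathcal S$ with parameters $a,\rho$, $k$ and parameter measure $l\mu$ (so that $\sum_j N_{i_j}(A)$ has the $\mathrm{GWD}(a,kl\mu(A);\rho)$ distribution for bounded Borel $A$); (3) for distinct indices $i_1,\dots,i_l\in\{1,\dots,m\}$, the process $(N_{i_1},\dots,N_{i_l})$ is a multivariate generalized Waring process (with $l$ components) with parameters $a,k,\rho$ and parameter measure $\mu$; in particular for all bounded Borel sets $A_1,\dots,A_l\subset\mathcal S$, $(N_{i_1}(A_1),\dots,N_{i_l}(A_l))$ has the $\mathrm{MGWD}(a;k\mu(A_1),\dots,k\mu(A_l);\rho)$ distribution; (4) for every $i$ and all bounded Borel sets $A,B\subset\mathcal S$, $(N_i(A),\sum_{j\ne i}N_j(B))$ has the $\mathrm{MGWD}(a;k\mu(A),(m-1)k\mu(B);\rho)$ (bivariate generalized Waring) distribution.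
   Context: For $x>0$, $\beta\ge0$ write $x_{(\beta)}=\Gamma(x+\beta)/\Gamma(x)$, with $0_{(0)}=1$ and $0_{(n)}=0$ for integers $n\ge1$. For $a,\rho>0$ and $k_1,\dots,k_s\ge 0$, $\mathrm{MGWD}(a;k_1,\dots,k_s;\rho)$ denotes the law on $\{0,1,2,\dots\}^s$ with $P(X_i=x_i,\ i=1,\dots,s)=\frac{\rho_{(\sum_i k_i)}\,a_{(\sum_i x_i)}}{(\rho+a)_{(\sum_i k_i+\sum_i x_i)}}\prod_{i=1}^s\frac{(k_i)_{(x_i)}}{x_i!}$; for $s=1$ it is $\mathrm{GWD}(a,k_1;\rho)$. A point process $N$ on a complete separable metric space $\mathcal S$ is a generalized Waring process with parameters $a,\rho,k>0$ and parameter measure $\mu$ (a boundedly finite Borel measure) if for every finite family of pairwise disjoint bounded Borel sets $A_1,\dots,A_l$, $(N(A_1),\dots,N(A_l))$ has the $\mathrm{MGWD}(a;k\mu(A_1),\dots,k\mu(A_l);\rho)$ distribution. Let $\nu$ be the Borel measure on $\mathcal S\times\{1,\dots,m\}$ given by $\nu(A\times C)=\mu(A)\cdot|C|$ for Borel $A\subset\mathcal S$ and $C\subset\{1,\dots,m\}$ (i.e. $\nu(A\times\{i\})=\mu(A)$). A multivariate generalized Waring process on $\mathcal S$ with parameters $a,k,\rho$ and parameter measure $\mu$ is a generalized Waring process on $\mathcal S\times\{1,\dots,m\}$ with parameters $a,k,\rho$ and parameter measure $\nu$. *)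

(* Defs.v *)
From HB Require Import structures.
From mathcomp Require Import all_boot all_order all_algebra.
From mathcomp Require Import all_classical all_reals all_analysis.
From mathcomp Require Import measurable_realfun.
Set Implicit Arguments. Unset Strict Implicit. Unset Printing Implicit Defensive.
Import Order.TTheory GRing.Theory Num.Theory.
Import numFieldNormedType.Exports.
Local Open Scope classical_set_scope.
Local Open Scope ring_scope.

Definition Gamma {R : realType} (x : R) : R :=
  fine (\int[@lebesgue_measure R]_(t in `]0%R, +oo[) (powR t (x - 1) * expR (- t))%:E)%E.

Definition poch {R : realType} (x b : R) : R :=
  if x == 0 then (if b == 0 then 1 else 0) else Gamma (x + b) / Gamma x.

Definition mgwd_pmf {R : realType} (s : nat) (a : R) (k : 'I_s -> R) (rho : R)
    (x : 'I_s -> nat) : R :=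
  let K := \sum_(i < s) k i in
  let X := (\sum_(i < s) x i)%N in
  poch rho K * poch a X%:R / poch (rho + a) (K + X%:R) *
  \prod_(i < s) (poch (k i) (x i)%:R / (x i)`!%:R).

Definition has_mgwd {R : realType} {d} {Omega : measurableType d}
    (P : probability Omega R) (s : nat) (Y : 'I_s -> Omega -> \bar R)
    (a : R) (k : 'I_s -> R) (rho : R) : Prop :=
  forall x : 'I_s -> nat,
    P [set w | forall i, Y i w = ((x i)%:R)%:E] = (mgwd_pmf a k rho x)%:E.

Definition borelType (S : ptopologicalType) := g_sigma_algebraType (@open S).

Definition mbounded {R : numDomainType} {S : pseudoMetricType R} (A : set S) : Prop :=
  A = set0 \/ exists (x : S) (r : R), A `<=` ball x r.

(* A point process on a space X with Borel sets [bor] and bounded sets [bdd]: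
   each realisation is a boundedly finite counting measure on [bor], and each
   count N(A) (A Borel) is a random variable. *)
Definition point_process {R : realType} {d} {Omega : measurableType d}
    (P : probability Omega R) {X : Type} (bor : set (set X)) (bdd : set X -> Prop)
    (N : Omega -> set X -> \bar R) : Prop :=
  (forall w, N w set0 = 0%E) /\
  (forall w A, bor A -> (exists n : nat, N w A = (n%:R)%:E) \/ N w A = +oo%E) /\
  (forall w A, bor A -> bdd A -> (N w A < +oo)%E) /\
  (forall w (F : nat -> set X), (forall n, bor (F n)) -> trivIset setT F ->
     ((fun n => \sum_(i < n) N w (F i)) @ \oo --> N w (\bigcup_n F n))%E) /\
  (forall A, bor A -> measurable_fun [set: Omega] (fun w => N w A)).

Definition gen_waring {R : realType} {d} {Omega : measurableType d}
    (P : probability Omega R) {X : Type} (bor : set (set X)) (bdd : set X -> Prop)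
    (a rho k : R) (nu : set X -> \bar R) (N : Omega -> set X -> \bar R) : Prop :=
  point_process P bor bdd N /\
  forall (l : nat) (A : 'I_l -> set X),
    (forall i, bor (A i) /\ bdd (A i)) ->
    (forall i j, i != j -> A i `&` A j = set0) ->
    has_mgwd P (fun i w => N w (A i)) a (fun i => k * fine (nu (A i))) rho.

Definition slice {S : Type} {m : nat} (B : set (S * 'I_m)) (i : 'I_m) : set S :=
  [set x | B (x, i)].

(* Borel sets of S x {1..m} (product of S with the finite discrete space) *)
Definition borel_prod (S : ptopologicalType) (m : nat) : set (set (S * 'I_m)) :=
  fun B => forall i, measurable (slice B i : set (borelType S)).

Definition bounded_prod {R : numDomainType} (S : pseudoMetricType R) (m : nat)
    (B : set (S * 'I_m)) : Prop := forall i, mbounded (slice B i).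

(* nu(B) = sum_i mu(B_i), i.e. the measure with nu(A x C) = mu(A) |C| *)
Definition nu_prod {R : realType} {S : Type} (m : nat) (mu : set S -> \bar R)
    (B : set (S * 'I_m)) : \bar R := (\sum_(i < m) mu (slice B i))%E.

Definition multi_gen_waring {R : realType} {d} {Omega : measurableType d}
    (P : probability Omega R) (S : completePseudoMetricType R) (m : nat)
    (a k rho : R) (mu : set S -> \bar R) (N : Omega -> set (S * 'I_m) -> \bar R) : Prop :=
  gen_waring P (@borel_prod S m) (@bounded_prod R S m) a rho k (@nu_prod R S m mu) N.

Definition comp_proc {R : realType} {Omega S : Type} {m : nat}
    (N : Omega -> set (S * 'I_m) -> \bar R) (i : 'I_m) : Omega -> set S -> \bar R :=
  fun w A => N w [set p | A p.1 /\ p.2 = i].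

(* Main.v *)
Require Import Defs.
From HB Require Import structures.
From mathcomp Require Import all_boot all_order all_algebra.
From mathcomp Require Import all_classical all_reals all_analysis.
From mathcomp Require Import measurable_realfun.
Import Order.TTheory GRing.Theory Num.Theory.
Local Open Scope classical_set_scope.
Local Open Scope ring_scope.

(* Every process in the statement counts N on cylinders A x C (A a Borel set of S, C a set of
   indices) or on the image of a subset of S x 'I_l under an injective relabelling of the
   indices.  These set maps preserve Borel sets, bounded sets, disjointness and countable
   unions, and they carry nu to |C| mu, resp. to nu itself; pulling N back along them therefore
   yields generalized Waring processes.  Joint laws of counts on cylinders with disjoint index
   sets are instances of the defining MGWD property of N, once a sum of component counts is
   identified with a single count by finite additivity. *)

Section PointProcess.
Context {R : realType} {d : measure_display} {Omega : measurableType d}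
  {P : probability Omega R}.

Lemma point_process_sum {X : Type} {bor : set (set X)} {bdd : set X -> Prop}
    {N : Omega -> set X -> \bar R} {n : nat} (G : 'I_n -> set X) (w : Omega) :
  point_process P bor bdd N -> bor set0 -> (forall i, bor (G i)) ->
  (forall i j, i != j -> G i `&` G j = set0) ->
  N w [set x | exists i, G i x] = (\sum_(i < n) N w (G i))%E.
Proof.
move=> [N0 [_ [_ [N_sigma _]]]] bor0 borG disjG.
(* extend G by empty sets to a sequence, to which sigma-additivity applies *)
pose F t := if @insub _ (fun t => (t < n)%N) 'I_n t is Some i then G i else set0.
have FG (i : 'I_n) : F i = G i by rewrite /F valK.
have F_ge t : (n <= t)%N -> F t = set0 by move=> nt; rewrite /F insubN // -leqNgt.
have F_ord t : (t < n)%N -> exists i : 'I_n, t = i /\ F t = G i.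
  by move=> tn; exists (Ordinal tn); split; last exact: FG (Ordinal tn).
have borF t : bor (F t).
  by case: (ltnP t n) => [/F_ord[i [_ ->]]|/F_ge ->].
have UF : [set x | exists i, G i x] = \bigcup_t F t.
  apply/seteqP; split => x /=; first by move=> [i Gix]; exists (val i); rewrite ?FG.
  move=> [t _]; case: (ltnP t n) => [/F_ord[i [_ ->]] Gix|/F_ge ->//].
  by exists i.
have trivF : trivIset setT F.
  move=> s t _ _ [x []].
  case: (ltnP s n) => [/F_ord[i [-> ->]]|/F_ge ->//].
  case: (ltnP t n) => [/F_ord[j [-> ->]]|/F_ge ->//] Gix Gjx.
  case: (eqVneq i j) => [-> //|ij].
  by have := disjG _ _ ij; move/seteqP => [/(_ x (conj Gix Gjx))].
have lim_partial : ((fun t => \sum_(i < t) N w (F i)) @ \oo -->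
    \sum_(i < n) N w (G i))%E.
  apply: cvg_near_cst; near=> t.
  have nt : (n <= t)%N by near: t; exists n.
  rewrite -(big_mkord xpredT (fun i => N w (F i))) (big_cat_nat (leq0n n) nt) /=.
  rewrite [X in (_ + X)%E]big_nat_cond [X in (_ + X)%E]big1 ?adde0; last first.
    by move=> i /andP[/andP[ni _] _]; rewrite F_ge.
  by rewrite big_mkord; apply: eq_bigr => i _; rewrite FG.
rewrite UF; exact: cvg_unique (N_sigma w F borF trivF) lim_partial.
Unshelve. all: end_near.
Qed.

Lemma gen_waring_pullback {X Y : Type} {bor : set (set X)} {bdd : set X -> Prop}
    {bor' : set (set Y)} {bdd' : set Y -> Prop} {a rho k : R}
    {nu : set X -> \bar R} {nu' : set Y -> \bar R}
    {N : Omega -> set X -> \bar R} {M : Omega -> set Y -> \bar R} (f : set Y -> set X) :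
  gen_waring P bor bdd a rho k nu N ->
  (forall w A, bor' A -> M w A = N w (f A)) ->
  bor' set0 -> f set0 = set0 ->
  (forall A, bor' A -> bor (f A)) ->
  (forall A, bor' A -> bdd' A -> bdd (f A)) ->
  (forall A B, bor' A -> bor' B -> A `&` B = set0 -> f A `&` f B = set0) ->
  (forall F : nat -> set Y, (forall n, bor' (F n)) ->
     bor' (\bigcup_n F n) /\ f (\bigcup_n F n) = \bigcup_n f (F n)) ->
  (forall A, bor' A -> bdd' A -> fine (nu (f A)) = fine (nu' A)) ->
  gen_waring P bor' bdd' a rho k nu' M.
Proof.
move=> [[N0 [Nval [Nfin [Nsigma Nmeas]]]] Nlaw] MN bor'0 f0 borf bddf disjf unionf nuf.
split; [split; [|split; [|split; [|split]]]|].
- by move=> w; rewrite MN // f0.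
- by move=> w A bA; rewrite MN //; apply/Nval/borf.
- by move=> w A bA dA; rewrite MN //; apply: Nfin; [apply: borf|apply: bddf].
- move=> w F borF trivF; have [borU fU] := unionf F borF.
  rewrite MN // fU; under eq_fun do under eq_bigr do rewrite MN //.
  apply: Nsigma => [n|s t _ _ [x [fFs fFt]]]; first exact: borf.
  apply: trivF => //; apply/set0P/negP => /eqP Fst0.
  by have := disjf _ _ (borF s) (borF t) Fst0; move/seteqP => [/(_ x (conj fFs fFt))].
- move=> A bA; rewrite (_ : (fun w => M w A) = fun w => N w (f A)).
    exact/Nmeas/borf.
  by apply: funext => w; rewrite MN.
- move=> l A bA disjA x.
  have -> : [set w | forall i, M w (A i) = ((x i)%:R)%:E] =
            [set w | forall i, N w (f (A i)) = ((x i)%:R)%:E].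
    by apply/seteqP; split => w /= Hw i; rewrite -Hw MN //; case: (bA i).
  have -> : (fun i => k * fine (nu' (A i))) = fun i => k * fine (nu (f (A i))).
    by apply: funext => i; case: (bA i) => ? ?; rewrite nuf.
  apply: Nlaw => [i|i j ij]; first by case: (bA i) => ? ?; split; [apply: borf|apply: bddf].
  by case: (bA i) => ? _; case: (bA j) => ? _; apply: disjf => //; apply: disjA.
Qed.

Lemma gen_waring_eq {X : Type} {bor : set (set X)} {bdd : set X -> Prop}
    {a rho k : R} {nu nu' : set X -> \bar R} {N M : Omega -> set X -> \bar R} :
  gen_waring P bor bdd a rho k nu N ->
  (forall w A, bor A -> M w A = N w A) ->
  bor set0 -> (forall (F : nat -> set X), (forall n, bor (F n)) -> bor (\bigcup_n F n)) ->
  (forall A, bor A -> bdd A -> fine (nu A) = fine (nu' A)) ->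
  gen_waring P bor bdd a rho k nu' M.
Proof.
move=> gwN MN bor0 borU nunu'.
apply: (gen_waring_pullback id gwN MN) => //.
by move=> F borF; split; [apply: borU|].
Qed.

Lemma eq_has_mgwd {s : nat} {Y Y' : 'I_s -> Omega -> \bar R} {a rho : R}
    {kappa kappa' : 'I_s -> R} :
  (forall t w, Y t w = Y' t w) -> (forall t, kappa t = kappa' t) ->
  has_mgwd P Y a kappa rho -> has_mgwd P Y' a kappa' rho.
Proof.
move=> YY' kk'; have -> : Y' = Y by apply: funext => t; apply: funext => w.
by have -> : kappa' = kappa by apply: funext.
Qed.

End PointProcess.

Definition cylinder {S : Type} {m : nat} (A : set S) (C : pred 'I_m) : set (S * 'I_m) :=
  [set p | A p.1 /\ C p.2].

Section Cylinder.
Context {S : Type} {m : nat}.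
Implicit Types (A B : set S) (C D : pred 'I_m).

Lemma slice_cylinder A C j : slice (cylinder A C) j = if C j then A else set0.
Proof.
apply/seteqP; rewrite /slice /cylinder; split => x /=; first by move=> [Ax ->].
by case: ifP.
Qed.

Lemma slice0 (j : 'I_m) : slice (set0 : set (S * 'I_m)) j = set0.
Proof. by apply/seteqP; split. Qed.

Lemma slice_bigcup (F : nat -> set (S * 'I_m)) j :
  slice (\bigcup_n F n) j = \bigcup_n slice (F n) j.
Proof. by apply/seteqP; split. Qed.

Lemma cylinder_pred1 A (i : 'I_m) : [set p | A p.1 /\ p.2 = i] = cylinder A (pred1 i).
Proof. by apply/seteqP; split => p /= [Ap /eqP]. Qed.

Lemma cylinder0 C : cylinder (set0 : set S) C = set0.
Proof. by apply/seteqP; split => p [] //. Qed.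

Lemma cylinder_bigcup (F : nat -> set S) C :
  cylinder (\bigcup_n F n) C = \bigcup_n cylinder (F n) C.
Proof.
apply/seteqP; split => p /=; first by move=> [[n _ Fp] Cp]; exists n.
by move=> [n _ [Fp Cp]]; split => //; exists n.
Qed.

Lemma cylinder_disjoint_base A B C D :
  A `&` B = set0 -> cylinder A C `&` cylinder B D = set0.
Proof.
move=> AB; apply/seteqP; split => p // [[Ap _] [Bp _]].
by have : (A `&` B) p.1 by []; rewrite AB.
Qed.

Lemma cylinder_disjoint_index A B C D :
  (forall j, C j -> ~~ D j) -> cylinder A C `&` cylinder B D = set0.
Proof. by move=> CD; apply/seteqP; split => p // [[_ /CD/negP Dp] [_ /Dp]]. Qed.

End Cylinder.

Lemma borel_prod_cylinder (S : ptopologicalType) (m : nat) (A : set (borelType S))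
    (C : pred 'I_m) :
  measurable A -> borel_prod (cylinder A C).
Proof. by move=> mA j; rewrite slice_cylinder; case: (C j). Qed.

Lemma borel_prod0 (S : ptopologicalType) (m : nat) : borel_prod (set0 : set (S * 'I_m)).
Proof. by move=> j; rewrite slice0. Qed.

Lemma bounded_prod_cylinder (R : numDomainType) (S : pseudoMetricType R) (m : nat)
    (A : set S) (C : pred 'I_m) :
  mbounded A -> bounded_prod (cylinder A C).
Proof. by move=> bA j; rewrite slice_cylinder; case: (C j) => //; left. Qed.

Lemma nu_prod_cylinder (R : realType) (S : ptopologicalType) (m : nat)
    (mu : {measure set (borelType S) -> \bar R}) (A : set S) (C : pred 'I_m) :
  nu_prod mu (cylinder A C) = ((#|C|%:R)%:E * mu A)%E.
Proof.
rewrite /nu_prod (eq_bigr (fun j => if C j then mu A else 0%E)) => [|j _]; last first.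
  by rewrite slice_cylinder; case: (C j); rewrite ?measure0.
by rewrite -big_mkcond sumr_const mule_natl.
Qed.

Definition relabel {S : Type} {l m : nat} (idx : 'I_l -> 'I_m) (B : set (S * 'I_l)) :
  set (S * 'I_m) := [set p | exists j, B (p.1, j) /\ p.2 = idx j].

Section Relabel.
Context {S : Type} {l m : nat} {idx : 'I_l -> 'I_m}.
Hypothesis idx_inj : injective idx.
Implicit Types B : set (S * 'I_l).

Lemma slice_relabel B j : slice (relabel idx B) (idx j) = slice B j.
Proof.
apply/seteqP; split => x /=; last by exists j.
by move=> [j' [Bj' /idx_inj ->]].
Qed.

Lemma slice_relabel_out B i : i \notin idx @: [set: 'I_l] ->
  slice (relabel idx B) i = set0.
Proof.
move=> iNidx; apply/seteqP; split => x //= [j [_ /= ij]].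
by move: iNidx; rewrite ij imset_f ?in_setT.
Qed.

Lemma relabel0 : relabel idx (set0 : set (S * 'I_l)) = set0.
Proof. by apply/seteqP; split => p // [j []]. Qed.

Lemma relabel_disjoint B B' : B `&` B' = set0 -> relabel idx B `&` relabel idx B' = set0.
Proof.
move=> BB'; apply/seteqP; split => p //= [[j [Bj pj]] [j' [B'j' pj']]].
move: B'j'; rewrite -(idx_inj _ _ (etrans (esym pj) pj')) => B'j.
by have : (B `&` B') (p.1, j) by []; rewrite BB'.
Qed.

Lemma relabel_bigcup (F : nat -> set (S * 'I_l)) :
  relabel idx (\bigcup_n F n) = \bigcup_n relabel idx (F n).
Proof.
apply/seteqP; split => p /=; first by move=> [j [[n _ Fp] pj]]; exists n => //; exists j.
by move=> [n _ [j [Fp pj]]]; exists j; split => //; exists n.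
Qed.

Lemma relabel_cylinder1 (A : set S) j :
  relabel idx (cylinder A (pred1 j)) = [set p | A p.1 /\ p.2 = idx j].
Proof.
apply/seteqP; split => p /=; first by move=> [j' [[Ap /= /eqP <-] ->]].
by move=> [Ap pj]; exists j; rewrite /cylinder /= eqxx.
Qed.

Lemma relabel_slices B i :
  (exists j, slice (relabel idx B) i = slice B j) \/ slice (relabel idx B) i = set0.
Proof.
case: (boolP (i \in idx @: [set: 'I_l])) => [/imsetP[j _ ->]|/slice_relabel_out->].
- by left; exists j; rewrite slice_relabel.
- by right.
Qed.

Lemma nu_prod_relabel (R : realType) (mu : set S -> \bar R) B :
  mu set0 = 0%E -> nu_prod mu (relabel idx B) = nu_prod mu B.
Proof.
move=> mu0; rewrite /nu_prod (bigID (mem (idx @: [set: 'I_l]))) /=.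
rewrite [X in (_ + X)%E]big1 ?adde0 => [|i iNidx]; last by rewrite slice_relabel_out.
rewrite big_imset /=; last by move=> ? ? _ _; apply: idx_inj.
by apply: eq_big => [j|j _]; rewrite ?in_setT ?slice_relabel.
Qed.

End Relabel.

Section MultiGenWaring.
Context {R : realType} {d : measure_display} {Omega : measurableType d}
  {P : probability Omega R} {S : completePseudoMetricType R} {m : nat} {a k rho : R}
  {mu : {measure set (borelType S) -> \bar R}} {N : Omega -> set (S * 'I_m) -> \bar R}.
Hypothesis gwN : multi_gen_waring P a k rho mu N.

Lemma multi_gen_waring_cylinder_sum (A : set (borelType S)) (C : pred 'I_m) w :
  measurable A -> N w (cylinder A C) = (\sum_(j < m | C j) N w (cylinder A (pred1 j)))%E.
Proof.
move=> mA; pose G j := if C j then cylinder A (pred1 j) else set0.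
have -> : cylinder A C = [set p | exists j, G j p].
  apply/seteqP; split => -[x i] /=.
    by move=> [Ax Ci]; exists i; rewrite /G Ci /cylinder /=.
  by move=> [j]; rewrite /G; case: ifP => // Cj [Ax /= /eqP ->].
have borG j : borel_prod (G j).
  by rewrite /G; case: (C j); [apply: borel_prod_cylinder|apply: borel_prod0].
have disjG i j : i != j -> G i `&` G j = set0.
  move=> ij; rewrite /G; case: (C i); case: (C j); rewrite ?set0I ?setI0 //.
  by apply: cylinder_disjoint_index => j' /eqP ->.
rewrite (point_process_sum G w gwN.1 (borel_prod0 _ _) borG disjG) [RHS]big_mkcond.
apply: eq_bigr => j _; rewrite /G.
by case: (C j) => //; apply: gwN.1.1.
Qed.

Lemma multi_gen_waring_cylinders {s : nat} {A : 'I_s -> set (borelType S)}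
    (C : 'I_s -> pred 'I_m) :
  (forall t, measurable (A t) /\ mbounded (A t : set S)) ->
  (forall t t', t != t' -> forall j, C t j -> ~~ C t' j) ->
  has_mgwd P (fun t w => N w (cylinder (A t) (C t))) a
    (fun t => k * fine ((#|C t|%:R)%:E * mu (A t))%E) rho.
Proof.
move=> Aok Cdisj.
have Gok t : borel_prod (cylinder (A t) (C t)) /\ bounded_prod (cylinder (A t) (C t)).
  by case: (Aok t) => mA bA; split; [apply: borel_prod_cylinder|apply: bounded_prod_cylinder].
have Gdisj t t' : t != t' -> cylinder (A t) (C t) `&` cylinder (A t') (C t') = set0.
  by move=> tt'; apply/cylinder_disjoint_index/Cdisj.
apply: eq_has_mgwd (gwN.2 s _ Gok Gdisj) => // t.
by rewrite nu_prod_cylinder.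
Qed.

Lemma multi_gen_waring_cylinder_process (C : pred 'I_m) :
  gen_waring P (measurable : set (set (borelType S))) (@mbounded R S) a rho k
    (fun A => ((#|C|%:R)%:E * mu A)%E) (fun w A => N w (cylinder A C)).
Proof.
apply: (gen_waring_pullback (fun A => cylinder A C) gwN) => //.
- exact: cylinder0.
- by move=> A mA; apply: borel_prod_cylinder.
- by move=> A _ bA; apply: bounded_prod_cylinder.
- by move=> A B _ _; apply: cylinder_disjoint_base.
- by move=> F mF; split; [apply: bigcupT_measurable|apply: cylinder_bigcup].
- by move=> A _ _; rewrite nu_prod_cylinder.
Qed.

Lemma multi_gen_waring_relabel {l : nat} {idx : 'I_l -> 'I_m} : injective idx ->
  multi_gen_waring P a k rho mu (fun w B => N w (relabel idx B)).
Proof.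
move=> idx_inj.
apply: (gen_waring_pullback (relabel idx) gwN) => //.
- exact: borel_prod0.
- exact: relabel0.
- by move=> B bB i; case: (relabel_slices idx_inj B i) => [[j ->]|->].
- by move=> B _ bB i; case: (relabel_slices idx_inj B i) => [[j ->]|->] //; left.
- by move=> B B' _ _; apply: relabel_disjoint.
- move=> F bF; split; last exact: relabel_bigcup.
  by move=> j; rewrite slice_bigcup; apply: bigcupT_measurable => n; apply: bF.
- by move=> B _ _; rewrite nu_prod_relabel // measure0.
Qed.

Lemma multi_gen_waring_component_complement (i : 'I_m) (A B : set (borelType S)) :
  measurable A -> mbounded (A : set S) -> measurable B -> mbounded (B : set S) ->
  has_mgwd P
    (fun (t : 'I_2) w => if t == ord0 then comp_proc N i w A
                         else (\sum_(j < m | j != i) comp_proc N j w B)%E)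
    a
    (fun t : 'I_2 => if t == ord0 then k * fine (mu A)
                     else k * fine (((m - 1)%:R)%:E * mu B)%E)
    rho.
Proof.
move=> mA bA mB bB.
pose As (t : 'I_2) := if t == ord0 then A else B.
pose Cs (t : 'I_2) := if t == ord0 then pred1 i else predC1 i.
have Asok t : measurable (As t) /\ mbounded (As t : set S) by rewrite /As; case: ifP.
have Csdisj t t' : t != t' -> forall j, Cs t j -> ~~ Cs t' j.
  rewrite /Cs; case: (t =P ord0) => [->|/eqP t0]; case: (t' =P ord0) => [->|/eqP t'0] //=.
  - by move=> _ j; rewrite negbK.
  - by case: t t0 => -[|[|?]] // ? _; case: t' t'0 => -[|[|?]] // ? _.
apply: eq_has_mgwd (multi_gen_waring_cylinders Cs Asok Csdisj) => t; rewrite /As /Cs.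
- case: ifP => _ w; first by rewrite /comp_proc cylinder_pred1.
  rewrite multi_gen_waring_cylinder_sum //.
  by apply: eq_bigr => j _; rewrite /comp_proc cylinder_pred1.
- by case: ifP => _; rewrite ?card1 ?mul1e // cardC1 card_ord subn1.
Qed.

End MultiGenWaring.

Theorem theorem11 (R : realType) (d : measure_display) (Omega : measurableType d)
  (P : probability Omega R)
  (S : completePseudoMetricType R)
  (S_metric : hausdorff_space S)
  (S_separable : exists D : set S, countable D /\ dense D)
  (mu : {measure set (borelType S) -> \bar R})
  (mu_bfin : forall A : set (borelType S), measurable A -> mbounded (A : set S) ->
     (mu A < +oo)%E)
  (m : nat) (hm : (2 <= m)%N) (a k rho : R) (ha : 0 < a) (hk : 0 < k) (hrho : 0 < rho)
  (N : Omega -> set (S * 'I_m) -> \bar R)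
  (hN : multi_gen_waring P a k rho mu N) :
  (forall i : 'I_m,
     gen_waring P (measurable : set (set (borelType S))) (@mbounded R S)
       a rho k mu (comp_proc N i)) /\
  (forall (l : nat) (idx : 'I_l -> 'I_m), injective idx ->
     gen_waring P (measurable : set (set (borelType S))) (@mbounded R S)
       a rho k (fun A => ((l%:R)%:E * mu A)%E)
       (fun w A => (\sum_(j < l) comp_proc N (idx j) w A)%E)) /\
  (forall (l : nat) (idx : 'I_l -> 'I_m), injective idx ->
     multi_gen_waring P a k rho mu
       (fun w B => N w [set p | exists j : 'I_l, B (p.1, j) /\ p.2 = idx j]) /\
     (forall A : 'I_l -> set (borelType S),
        (forall j, measurable (A j) /\ mbounded (A j : set S)) ->
        has_mgwd P (fun j w => comp_proc N (idx j) w (A j)) a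
          (fun j => k * fine (mu (A j))) rho)) /\
  (forall (i : 'I_m) (A B : set (borelType S)),
     measurable A -> mbounded (A : set S) -> measurable B -> mbounded (B : set S) ->
     has_mgwd P
       (fun (t : 'I_2) w => if t == ord0 then comp_proc N i w A
                            else (\sum_(j < m | j != i) comp_proc N j w B)%E)
       a
       (fun t : 'I_2 => if t == ord0 then k * fine (mu A)
                        else (m - 1)%:R * k * fine (mu B))
       rho).
Proof.
split; [|split; [|split]].
- move=> i; apply: (gen_waring_eq (multi_gen_waring_cylinder_process hN (pred1 i)) _ measurable0
    bigcupT_measurable).
  + by move=> w A _; rewrite /comp_proc cylinder_pred1.
  + by move=> A _ _; rewrite card1 mul1e.
- move=> l idx idx_inj; have gwl := multi_gen_waring_relabel hN idx_inj.
  apply: (gen_waring_eq (multi_gen_waring_cylinder_process gwl predT) _ measurable0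
    bigcupT_measurable).
  + move=> w A mA; have /= -> := multi_gen_waring_cylinder_sum gwl A predT w mA.
    by apply: eq_bigr => j _; rewrite relabel_cylinder1.
  + by move=> A _ _; rewrite card_ord.
- move=> l idx idx_inj; have gwl := multi_gen_waring_relabel hN idx_inj.
  split => // A Aok; apply: eq_has_mgwd (multi_gen_waring_cylinders gwl (fun j => pred1 j) Aok _).
  + by move=> j w; rewrite relabel_cylinder1.
  + by move=> j; rewrite card1 mul1e.
  + by move=> j j' jj' j'' /eqP ->.
move=> i A B mA bA mB bB.
apply: eq_has_mgwd (multi_gen_waring_component_complement hN i A B mA bA mB bB) => // t.
case: ifP => // _.
have muB_fin : mu B \is a fin_num by rewrite ge0_fin_numE ?measure_ge0 ?mu_bfin.
by rewrite fineM // mulrCA mulrA.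
Qed.
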